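(* Any virtual knot has a virtual petal diagram.
   Context: A virtual knot diagram is a generic immersion of a circle in the plane whose transverse double points are each marked either as classical (with over/under information) or as virtual. A virtual knot is an equivalence class of such diagrams under planar isotopy, the classical Reidemeister moves, and the virtual Reidemeister moves (equivalently, detour moves: an arc containing only virtual crossings may be replaced by any other generic arc with the same endpoints, all of whose crossings are virtual). Equivalently, a virtual knot is determined by the signed Gauss code of any of its diagrams, which records classical crossings only. A virtual $n$-crossing consists of $n$ strands passing through a common point in the plane, each bisecting the crossing (so among the $2n$ ends in cyclic order, each strand joins opposite ends), together with: (1) an assignment of distinct heights $1,\dots,n$ to the strands ($1$ being the top); and (2) a set of pairs of strands declared to be virtual, all other pairs being classical, subject to the validity condition that no three strands have exactly one virtual pair and two classical pairs among their three pairs. A resolution of a virtual $n$-crossing is obtained by isotoping the strands, keeping ends fixed, so that any two strands meet in exactly one point and no three share a point; the double point of a virtual pair is a virtual crossing, and the double point of a classical pair is a classical crossing in which the strand with the higher position (smaller label) is the overstrand. All resolutions of a virtual $n$-crossing are related by allowed classical and virtual Reidemeister moves. A virtual petal diagram is a closed curve in the plane with a single multiple point, which is a (valid) virtual $n$-crossing for some $n$, such that the $n$ loops (petals) attached to the crossing are not nested; that is, outside the crossing the $2n$ ends are joined by $n$ pairwise disjoint, non-nested simple arcs, each joining two cyclically adjacent ends. It is a virtual petal diagram of the virtual knot $K$ if its resolution is a virtual knot diagram of $K$. *)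

(* Defs.v *)
From mathcomp Require Import all_boot all_fingroup.
From Stdlib Require Import Relations.

Set Implicit Arguments.
Unset Strict Implicit.
Unset Printing Implicit Defensive.

(* Virtual knots are presented by signed Gauss codes: only the classical
   crossings of a diagram are recorded, and planar isotopies, virtual
   Reidemeister moves and detour moves do not change the code.              *)

(* ((x, o), s): a passage through crossing x, over if o and under otherwise;
   s is the sign of the crossing, true meaning positive.                    *)
Definition letter := (nat * bool * bool)%type.

Definition label (x : letter) : nat := x.1.1.
Definition over (x : letter) : bool := x.1.2.
Definition sign (x : letter) : bool := x.2.

Definition is_gauss_word (w : seq letter) : bool :=
  all (fun x => (count (fun y => label y == label x) w == 2)
                && ((label x, ~~ over x, sign x) \in w)) w.

Record gauss_code := GaussCode {
  gauss_word :> seq letter;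
  gauss_wordP : is_gauss_word gauss_word
}.

Definition in_order (b : bool) (x y : letter) : seq letter :=
  if b then [:: x; y] else [:: y; x].

(* The three passages of a third Reidemeister move between a top, a middle
   and a bottom strand, meeting at the crossings a (top/middle),
   b (top/bottom) and c (middle/bottom).  Let t, m, d be the directions of
   the strands, so that (sa, sb, sc) are the signs of det(t, m), det(t, d),
   det(m, d), and write b - a = A t, c - a = B m, c - b = C d in the plane.
   Then B m = A t + C d, and taking determinants, the signs of (A, B, C) are
   (sc, sb, sa) up to a common factor; the move reverses that factor l.     *)
Definition r3_top (a b : nat) (sa sb sc l : bool) : seq letter :=
  in_order (l == sc) (a, true, sa) (b, true, sb).
Definition r3_mid (a c : nat) (sa sb sc l : bool) : seq letter :=
  in_order (l == sb) (a, false, sa) (c, true, sc).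
Definition r3_bot (b c : nat) (sa sb sc l : bool) : seq letter :=
  in_order (l == sa) (b, false, sb) (c, false, sc).

(* The base point and the direction in which a code is read are not part of
   the (unoriented) knot, hence [rotate] and [reverse]; reversing the
   direction preserves the signs of the crossings.  Freshness of the labels
   involved follows from both sides being Gauss codes.                      *)
Inductive gauss_move : seq letter -> seq letter -> Prop :=
| rotate u v : gauss_move (u ++ v) (v ++ u)
| reverse u : gauss_move u (rev u)
| relabel (f : nat -> nat) u : injective f ->
    gauss_move u [seq (f (label x), over x, sign x) | x <- u]
| reidemeister1 a o s u v :
    gauss_move (u ++ [:: (a, o, s); (a, ~~ o, s)] ++ v) (u ++ v)
| reidemeister2 a b o s d u v w :
    gauss_move (u ++ [:: (a, o, s); (b, o, ~~ s)]
                  ++ v ++ in_order d (a, ~~ o, s) (b, ~~ o, ~~ s) ++ w)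
               (u ++ v ++ w)
| reidemeister3_tmb a b c sa sb sc l u v w z :
    gauss_move (u ++ r3_top a b sa sb sc l ++ v ++ r3_mid a c sa sb sc l
                  ++ w ++ r3_bot b c sa sb sc l ++ z)
               (u ++ r3_top a b sa sb sc (~~ l)
                  ++ v ++ r3_mid a c sa sb sc (~~ l)
                  ++ w ++ r3_bot b c sa sb sc (~~ l) ++ z)
| reidemeister3_tbm a b c sa sb sc l u v w z :
    gauss_move (u ++ r3_top a b sa sb sc l ++ v ++ r3_bot b c sa sb sc l
                  ++ w ++ r3_mid a c sa sb sc l ++ z)
               (u ++ r3_top a b sa sb sc (~~ l)
                  ++ v ++ r3_bot b c sa sb sc (~~ l)
                  ++ w ++ r3_mid a c sa sb sc (~~ l) ++ z).

Definition gauss_equiv : gauss_code -> gauss_code -> Prop :=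
  clos_refl_sym_trans gauss_code (fun D E => gauss_move D E).

Record virtual_knot := VirtualKnot {
  knot_code :> gauss_code -> Prop;
  knot_codeP : exists D, forall E, knot_code E <-> gauss_equiv D E
}.

Definition represents (w : seq letter) (K : virtual_knot) : Prop :=
  exists2 D : gauss_code, gauss_word D = w & K D.

(* The ends of a virtual n-crossing are numbered 0, ..., n.*2.-1
   counterclockwise, and strand i joins the ends i and i + n.  Heights are
   numbered from 0, the top.                                                *)
Record virtual_crossing (n : nat) := VirtualCrossing {
  height : {perm 'I_n};
  virt : rel 'I_n;
  virt_irr : forall i, virt i i = false;
  virt_sym : forall i j, virt i j = virt j i;
  virt_valid : forall i j k : 'I_n, i != j -> j != k -> i != k ->
    virt i j + virt j k + virt i k != 1
}.

(* The disc around the crossing is drawn with the ends 0, ..., n.-1 on its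
   left side, from top to bottom, and swept from left to right; the lists
   give the strands from top to bottom.  [sweep s c t] holds when the order
   changes from s to t through the successive double points c, where (i, j)
   is a double point at which i passes from just above j to just below j.
   Every simple arrangement of strands in the disc has such a sweep.        *)
Inductive sweep (T : Type) : seq T -> seq (T * T) -> seq T -> Prop :=
| sweep_nil s : sweep s [::] s
| sweep_cons u i j v c t :
    sweep (u ++ j :: i :: v) c t -> sweep (u ++ i :: j :: v) ((i, j) :: c) t.

Definition is_resolution (n : nat) (c : seq ('I_n * 'I_n)) : Prop :=
  sweep (enum 'I_n) c (rev (enum 'I_n)) /\
  forall i j : 'I_n, i != j ->
    count (fun p => (p == (i, j)) || (p == (j, i))) c = 1.

(* The petals join the ends 2k and 2k + 1; the other way of joining
   cyclically adjacent ends differs from this one by a rotation.            *)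
Definition petal (e : nat) : nat := if odd e then e.-1 else e.+1.

Definition opposite_end (n e : nat) : nat := (e + n) %% n.*2.

(* The ends through which the curve successively enters the crossing, when
   it first enters through the end 0.                                       *)
Definition entries (n : nat) : seq nat :=
  traject (fun e => petal (opposite_end n e)) 0 n.

(* Some choices of n give several closed curves (a link); petal_curve asks
   that the curve through the end 0 traverse all the strands.               *)
Record virtual_petal_diagram := VirtualPetalDiagram {
  petals : nat;
  petal_crossing : virtual_crossing petals;
  petals_gt0 : 0 < petals;
  petal_curve : uniq [seq e %% petals | e <- entries petals]
}.

Section PetalWord.

Variables (n : nat) (X : virtual_crossing n) (c : seq ('I_n * 'I_n)).

Definition rightward (i : 'I_n) : bool := (i : nat) \in entries n.

Definition above (i j : 'I_n) : bool := height X i < height X j.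

(* The strands i < j, both directed rightward, have det(i, j) > 0, and a
   crossing is positive when det(over, under) > 0.                          *)
Definition crossing_sign (i j : 'I_n) : bool :=
  let: (o, u) := if above i j then (i, j) else (j, i) in
  (o < u) == (rightward o == rightward u).

Definition passage (i : 'I_n) (p : 'I_n * 'I_n) : letter :=
  let j := if p.1 == i then p.2 else p.1 in
  (index p c, above i j, crossing_sign i j).

Definition rightward_word (i : 'I_n) : seq letter :=
  [seq passage i p | p <- c & ((p.1 == i) || (p.2 == i)) && ~~ virt X p.1 p.2].

Definition strand_word (i : 'I_n) : seq letter :=
  if rightward i then rightward_word i else rev (rightward_word i).

(* [pmap insub] reads the strand numbers e %% n < n as elements of 'I_n.    *)
Definition petal_word : seq letter :=
  flatten [seq strand_word i
          | i <- pmap insub [seq e %% n | e <- entries n]].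

End PetalWord.

(* All the resolutions of a valid crossing give the same virtual knot, so
   the resolution may be any one of them.                                   *)
Definition petal_diagram_of (P : virtual_petal_diagram) (K : virtual_knot) :
    Prop :=
  (exists c : seq ('I_(petals P) * 'I_(petals P)), is_resolution c) /\
  (forall c : seq ('I_(petals P) * 'I_(petals P)), is_resolution c ->
     represents (petal_word (petal_crossing P) c) K).

(* Main.v *)
(* Validity says that being classical is a transitive relation, so disjoint
   classical pairs with all other pairs virtual always form a valid crossing.
   With an odd number 2N+1 of strands, the curve of a petal diagram traverses
   the strands 0, 2N, 2N-1, ..., 1, the even ones rightward and the odd ones
   leftward.  Given a Gauss code with N letters, put each letter on one of two
   consecutive strands and make the two strands of each crossing a classical
   pair: heights give the over/under information, and the choice between the
   two strands, which have opposite directions, gives the sign.  The strands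
   left over cross virtually only, so the diagram has the given Gauss code up
   to relabelling.                                                           *)

From Stdlib Require Import Relations.
From mathcomp Require Import all_boot all_fingroup zify.
Require Import Defs.

Set Implicit Arguments.
Unset Strict Implicit.
Unset Printing Implicit Defensive.

(** * Auxiliary facts on injections and lists *)

(** A [relabel] move needs a globally injective function, but new labels are determined only on the
    labels that occur. Off [A], a shift beyond all values of [g] on [A] avoids collisions. *)
Lemma extend_injection (A : seq nat) (g : nat -> nat) :
  {in A &, injective g} -> exists2 f, injective f & {in A, f =1 g}.
Proof.
move=> g_inj; pose m := (\max_(a <- A) g a).+1.
have g_lt a : a \in A -> g a < m by move=> aA; rewrite ltnS leq_bigmax_seq.
exists (fun a => if a \in A then g a else a + m); last by move=> a /= ->.
move=> a b; case: ifPn => aA; case: ifPn => bA; first exact: g_inj.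
- by have := g_lt a aA; lia.
- by have := g_lt b bA; lia.
- by lia.
Qed.

Lemma flatten_map_if (S T : Type) (a : pred S) (h : S -> T) (s : seq S) :
  flatten [seq if a x then [:: h x] else [::] | x <- s]
  = [seq h x | x <- s & a x].
Proof. by elim: s => //= x s ->; case: (a x). Qed.

(** * Sweeps *)

Lemma sweep_cat (T : Type) (s t u : seq T) c d :
  sweep s c t -> sweep t d u -> sweep s (c ++ d) u.
Proof. by elim=> //= *; apply: sweep_cons; auto. Qed.

Lemma sweep_catr (T : Type) (r s t : seq T) c :
  sweep s c t -> sweep (s ++ r) c (t ++ r).
Proof.
elim=> [?|p i j v {}c {}t _ IH]; first exact: sweep_nil.
by move: IH; rewrite -!catA /=; apply: sweep_cons.
Qed.

Lemma sweep_catl (T : Type) (r s t : seq T) c :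
  sweep s c t -> sweep (r ++ s) c (r ++ t).
Proof.
elim=> [?|p i j v {}c {}t _ IH]; first exact: sweep_nil.
by move: IH; rewrite !catA; apply: sweep_cons.
Qed.

Lemma sweep_down (T : Type) (x : T) s :
  sweep (x :: s) [seq (x, y) | y <- s] (rcons s x).
Proof.
elim: s => [|y s IH] /=; first exact: sweep_nil.
by apply: (@sweep_cons _ [::]) => /=; apply: (@sweep_catl _ [:: y]) IH.
Qed.

(** Each swap keeps the list duplicate-free. This rules out double points [(i, i)], on which the
    counts in [is_resolution] are silent. *)
Lemma sweep_neq (T : eqType) (s t : seq T) c :
  uniq s -> sweep s c t -> all (fun p => p.1 != p.2) c.
Proof.
move=> + sw; elim: sw => // u i j v {}c {}t _ IH /= u_s.
have pm : perm_eq (u ++ j :: i :: v) (u ++ i :: j :: v).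
  by rewrite perm_cat2l (perm_catCA [:: j] [:: i] v).
rewrite IH ?(perm_uniq pm) // andbT.
by move: u_s; rewrite cat_uniq => /and3P[_ _ /andP[]]; rewrite inE negb_or => /andP[].
Qed.

Fixpoint pairs (T : Type) (s : seq T) : seq (T * T) :=
  if s is x :: s' then [seq (x, y) | y <- s'] ++ pairs s' else [::].

(** The first strand descends past all the others, then the second past those still above the first,
    and so on. *)
Lemma sweep_pairs (T : Type) (s : seq T) : sweep s (pairs s) (rev s).
Proof.
elim: s => [|x s IH] /=; first exact: sweep_nil.
apply: sweep_cat (sweep_down x s) _.
by rewrite rev_cons -!cats1; apply: sweep_catr.
Qed.

(** Only the row of whichever of [i] and [j] comes first in [s] contains the pair, and it does so
    once. *)
Lemma count_pairs (T : eqType) (s : seq T) i j :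
  uniq s -> i != j -> i \in s -> j \in s ->
  count (fun p => (p == (i, j)) || (p == (j, i))) (pairs s) = 1.
Proof.
move=> + ij; elim: s => //= x s IH /andP[xs us].
have pairs0 k l : (k \notin s) || (l \notin s) ->
    count (fun p => (p == (k, l)) || (p == (l, k))) (pairs s) = 0.
  elim: s {IH xs us} => //= y s IH; rewrite !inE !negb_or => H.
  rewrite count_cat count_map IH; last by lia.
  rewrite addn0; apply/eqP; rewrite -leqn0 leqNgt -has_count -all_predC.
  apply/allP => z zs /=; rewrite !xpair_eqE.
  apply/negP => /orP[] /andP[/eqP E1 /eqP E2]; subst;
    by move: H; rewrite !eqxx zs ?andbF.
have row k : k \in s ->
    count (fun y => ((x, y) == (x, k)) || ((x, y) == (k, x))) s = 1.
  move=> ks; have <- : count_mem k s = 1 by rewrite count_uniq_mem ?ks.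
  have xk : x != k by apply: contraNneq xs => ->.
  by apply: eq_count => y /=; rewrite !xpair_eqE eqxx (negbTE xk) orbF.
rewrite !inE count_cat count_map => /orP[/eqP Ei|si] /orP[/eqP Ej|sj].
- by rewrite Ei Ej eqxx in ij.
- by subst; rewrite pairs0 ?xs // addn0 -[RHS](row j sj).
- subst; rewrite pairs0 ?xs ?orbT // addn0 -[RHS](row i si).
  by apply: eq_count => y /=; rewrite orbC.
rewrite IH // (@eq_count _ _ pred0) ?count_pred0 // => y /=.
rewrite !xpair_eqE; apply/negP => /orP[] /andP[/eqP E _]; subst;
  by rewrite ?si ?sj in xs.
Qed.

Lemma resolution_exists n : exists c : seq ('I_n * 'I_n), is_resolution c.
Proof.
exists (pairs (enum 'I_n)); split; first exact: sweep_pairs.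
by move=> i j ij; rewrite count_pairs ?enum_uniq ?mem_enum.
Qed.

(** * Crossings with disjoint classical pairs *)

Section Matching.

Variables (n : nat) (mate : 'I_n -> 'I_n) (is_over : pred 'I_n).
Hypothesis mateK : involutive mate.
Hypothesis is_over_mate : forall i, mate i != i -> is_over (mate i) = ~~ is_over i.

(** Heights matter only between mates, so strand numbers serve as heights, exchanged between two
    mates exactly when the overstrand has the larger number. *)
Definition matching_height (i : 'I_n) : 'I_n :=
  if is_over i == (mate i < i) then mate i else i.

Lemma matching_heightK : involutive matching_height.
Proof.
move=> i; rewrite /matching_height; have [mi|mi] := eqVneq (mate i) i.
  by rewrite mi !if_same ?mi !if_same.
have mi' : nat_of_ord (mate i) != i by [].
case: (boolP (is_over i == (mate i < i))) => [E|/negbTE->//].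
(* Passing to the mate negates both sides of the test, so its outcome is the same. *)
rewrite mateK is_over_mate // ifT //; lia.
Qed.

Definition matching_virt : rel 'I_n := fun i j => (i != j) && (mate i != j).

Lemma matching_virt_irr i : matching_virt i i = false.
Proof. by rewrite /matching_virt eqxx. Qed.

Lemma matching_virt_sym i j : matching_virt i j = matching_virt j i.
Proof. by rewrite /matching_virt eq_sym (inv_eq mateK) [_ == mate j]eq_sym. Qed.

(** Two classical pairs among three strands would share a strand with two mates, so at least two
    pairs are virtual. *)
Lemma matching_virt_valid (i j k : 'I_n) : i != j -> j != k -> i != k ->
  matching_virt i j + matching_virt j k + matching_virt i k != 1.
Proof.
rewrite /matching_virt => ij jk ik; rewrite ij jk ik.
have [ij'|_] := eqVneq (mate i) j; have [jk'|_] := eqVneq (mate j) k;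
  have [ik'|_] := eqVneq (mate i) k => //=.
- by rewrite -jk' -ij' mateK eqxx in ik.
- by rewrite -ij' ik' eqxx in jk.
- by rewrite -ik' in jk'; rewrite (inv_inj mateK jk') eqxx in ij.
Qed.

Definition matching_crossing : virtual_crossing n :=
  VirtualCrossing (perm (inv_inj matching_heightK))
    matching_virt_irr matching_virt_sym matching_virt_valid.

Lemma matching_above i : mate i != i ->
  above matching_crossing i (mate i) = is_over i.
Proof.
move=> mi; rewrite /above /= !permE /matching_height mateK is_over_mate //.
have mi' : nat_of_ord (mate i) != i by [].
have -> : (~~ is_over i == (i < mate i)) = (is_over i == (mate i < i)) by lia.
by case: eqP; lia.
Qed.

Variable c : seq ('I_n * 'I_n).
Hypothesis c_res : is_resolution c.

(** Being symmetric in [i] and [mate i], this gives both strands the same crossing label through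
    [find]. *)
Definition mate_pair i : pred ('I_n * 'I_n) :=
  fun p => (p == (i, mate i)) || (p == (mate i, i)).

Lemma find_mate_pair_lt i : mate i != i -> find (mate_pair i) c < size c.
Proof.
by move=> mi; rewrite -has_find has_count (c_res.2 i (mate i)) // eq_sym.
Qed.

Lemma find_mate_pair_mate i : find (mate_pair (mate i)) c = find (mate_pair i) c.
Proof. by apply: eq_find => p; rewrite /mate_pair mateK orbC. Qed.

Lemma find_mate_pair_inj i j : mate i != i -> mate j != j ->
  find (mate_pair i) c = find (mate_pair j) c -> j = i \/ j = mate i.
Proof.
move=> mi mj E; have := find_mate_pair_lt mi; have := find_mate_pair_lt mj.
rewrite -!has_find => /(nth_find (i, i)) + /(nth_find (i, i)); rewrite E.
by rewrite /mate_pair => /orP[]/eqP-> /orP[]/eqP[]; auto.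
Qed.

(** A strand has at most one classical crossing, so its word is unaffected by [rev] and the
    direction of traversal enters only through the sign. *)
Lemma matching_strand_word i :
  strand_word matching_crossing c i =
  if mate i != i then
    [:: (find (mate_pair i) c, is_over i,
         crossing_sign matching_crossing i (mate i))]
  else [::].
Proof.
have c_neq := sweep_neq (enum_uniq _) c_res.1.
have sel p : p \in c ->
    ((p.1 == i) || (p.2 == i)) && ~~ matching_virt p.1 p.2
    = (mate i != i) && mate_pair i p.
  case: p => x y /(allP c_neq) /= xy.
  rewrite /matching_virt /mate_pair !xpair_eqE xy /= negbK.
  apply/idP/idP.
    case/andP=> /orP[]/eqP<- /eqP E; first by rewrite E eq_sym xy !eqxx.
    by rewrite -E in xy *; rewrite mateK xy !eqxx orbT.
  by case/andP=> _ /orP[]/andP[/eqP-> /eqP->]; rewrite ?mateK !eqxx ?orbT.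
rewrite /strand_word /rightward_word (eq_in_filter sel).
have [mi|mi] /= := eqVneq (mate i) i; first by rewrite filter_pred0; case: ifP.
have sz : size (filter (mate_pair i) c) = 1.
  by rewrite size_filter (c_res.2 i (mate i)) // eq_sym.
case E: (filter _ c) sz => [|p []] //= _.
(* [p] is the only value in [c] satisfying [mate_pair i]. *)
have idx : find (mate_pair i) c = index p c.
  apply: eq_in_find => q qc.
  by rewrite /= -(mem_seq1 q p) -E mem_filter qc andbT.
have : p \in filter (mate_pair i) c by rewrite E mem_head.
rewrite idx /passage /=.
rewrite mem_filter => /andP[/orP[]/eqP-> _].
  by rewrite eqxx matching_above // if_same.
by rewrite (negbTE mi) matching_above // if_same.
Qed.

End Matching.

(** * The curve of a petal diagram with an odd number of strands *)

(** The number of strands being odd, the end opposite an even end is odd, and its petal leads one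
    end down. So entries stay even, and the strand number drops by one modulo [N.*2.+1] each time.
    The end 0 is set apart because the general formula would give [N.*2.+1.*2]. *)
Lemma iter_entry N t : t < N.*2.+1 ->
  iter t (fun e => petal (opposite_end N.*2.+1 e)) 0 =
  if t == 0 then 0 else if odd t then N.*2.+1 - t else N.*2.+1.*2 - t.
Proof.
elim: t => // t IH lt_t; rewrite iterS IH; last by lia.
have opp0 : opposite_end N.*2.+1 0 = N.*2.+1.
  by rewrite /opposite_end modn_small //; lia.
have oppD k : k < N.*2.+1 -> opposite_end N.*2.+1 (N.*2.+1 + k) = k.
  by move=> ?; rewrite /opposite_end addnAC addnn modnDl modn_small //; lia.
have oppB k : k < N.*2.+1 -> opposite_end N.*2.+1 k = N.*2.+1 + k.
  by move=> ?; rewrite /opposite_end modn_small; lia.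
have [->|t0] := eqVneq t 0.
  by rewrite opp0 /petal /= odd_double subSS subn0.
case: ifP => odd_t.
  rewrite oppB; last by lia.
  by rewrite /petal; case: ifP; case: ifP; lia.
have -> : N.*2.+1.*2 - t = N.*2.+1 + (N.*2.+1 - t) by lia.
rewrite oppD; last by lia.
by rewrite /petal; case: ifP; case: ifP; lia.
Qed.

Lemma entries_strands N :
  [seq e %% N.*2.+1 | e <- entries N.*2.+1] = 0 :: rev (iota 1 N.*2).
Proof.
apply: (@eq_from_nth _ 0) => [|t].
  by rewrite size_map size_traject /= size_rev size_iota.
rewrite size_map size_traject => lt_t.
rewrite (nth_map 0) ?size_traject // nth_traject // iter_entry //.
case: t lt_t => [|t] lt_t //=.
rewrite nth_rev ?size_iota // nth_iota; last by lia.
case: ifP => _; first by rewrite modn_small; lia.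
have -> : N.*2.+1.*2 - t.+1 = N.*2.+1 + (N.*2.+1 - t.+1) by lia.
by rewrite modnDl modn_small; lia.
Qed.

Lemma rightward_even N (i : 'I_N.*2.+1) : rightward i = ~~ odd i.
Proof.
have lt_i := ltn_ord i.
apply/trajectP/idP => [[t lt_t ->]|even_i].
  by rewrite iter_entry //; case: ifP => // ?; case: ifP; lia.
have [i0|i0] := eqVneq (i : nat) 0; first by exists 0.
(* Strand [i > 0] is entered at this time, which is odd as [i] is even, hence through its left
   end. *)
exists (N.*2.+1 - i); first by lia.
rewrite iter_entry; last by lia.
by case: ifP; [lia | case: ifP; lia].
Qed.

Lemma entries_curve N :
  uniq [seq e %% N.*2.+1 | e <- entries N.*2.+1].
Proof.
by rewrite entries_strands /= mem_rev mem_iota rev_uniq iota_uniq andbT.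
Qed.

(** * The petal diagram of a Gauss code *)

Definition flip (x : letter) : letter := (label x, ~~ over x, sign x).

Lemma flipK : involutive flip.
Proof. by case=> [[a o] s]; rewrite /flip /= negbK. Qed.

Lemma flip_neq x : flip x != x.
Proof. by case: x => [[a []] s]; apply/eqP => -[]. Qed.

Section GaussWord.

Variable w : seq letter.
Hypothesis w_code : is_gauss_word w.

Lemma mem_flip x : x \in w -> flip x \in w.
Proof. by move=> /(allP w_code)/andP[]. Qed.

(** Both [x] and [flip x] occur, and they exhaust the two letters with this label. *)
Lemma count_label x : x \in w ->
  count_mem x w = 1 /\
  count (fun y => [&& label y == label x, y != x & y != flip x]) w = 0.
Proof.
move=> xw; have [/eqP E fw] := andP (allP w_code x xw).
have splitE s : count (fun y => label y == label x) s =
    count_mem x s + count_mem (flip x) s +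
    count (fun y => [&& label y == label x, y != x & y != flip x]) s.
  elim: s => //= y s ->; have [->|yx] := eqVneq y x.
    by rewrite eqxx [x == _]eq_sym (negbTE (flip_neq x)) /=; lia.
  by have [->|yf] := eqVneq y (flip x); rewrite ?eqxx ?andbT /=; lia.
have {}fw : 0 < count_mem (flip x) w by rewrite -has_count has_pred1.
have cx : 0 < count_mem x w by rewrite -has_count has_pred1.
by move: E; rewrite splitE; lia.
Qed.

Lemma gauss_uniq : uniq w.
Proof.
apply: count_mem_uniq => x; case: (boolP (x \in w)) => [/count_label[]//|xw].
exact/count_memPn.
Qed.

Lemma same_label x y : x \in w -> y \in w -> label y = label x ->
  y = x \/ y = flip x.
Proof.
move=> /count_label[_ /eqP]; rewrite -leqn0 leqNgt -has_count -all_predC.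
move=> /allP H /H /= + E; rewrite E eqxx /= negb_and !negbK.
by case/orP => /eqP; auto.
Qed.

(** * Placing the letters on strands *)

Local Notation N := (size w).
Local Notation n := N.*2.+1.

(* Each letter may go to one of two neighbouring strands, traversed in opposite
   directions; the choice for the overstrand produces the right sign. *)
Definition goes_right (x : letter) : bool :=
  ~~ over x || (sign x == (index (flip x) w < index x w)).

(** The curve meets the nonzero strands in decreasing order, so position [k] of [w] gets the strands
    [(N - k).*2] and [(N - k).*2.-1]; strand 0 stays free. *)
Definition strand (x : letter) : 'I_n :=
  inord ((N - index x w).*2 - ~~ goes_right x).

Definition letter_at (i : nat) : letter :=
  nth (0, false, false) w (N - uphalf i).

Lemma strandE x : strand x = (N - index x w).*2 - ~~ goes_right x :> nat.
Proof. by rewrite inordK //; lia. Qed.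

Lemma strandK x : x \in w -> letter_at (strand x) = x.
Proof.
move=> xw; have lt_x : index x w < N by rewrite index_mem.
rewrite /letter_at strandE.
have -> : uphalf ((N - index x w).*2 - ~~ goes_right x) = N - index x w.
  by case: goes_right => /=; lia.
by rewrite subKn 1?ltnW // nth_index.
Qed.

(** Distinct positions differ by at least 2 after doubling, so subtracting 1 cannot change their
    order. *)
Lemma strand_ltE x y : x \in w -> y \in w -> x != y ->
  (strand x < strand y) = (index y w < index x w).
Proof.
move=> xw yw xy; rewrite !strandE.
have lt_x : index x w < N by rewrite index_mem.
have lt_y : index y w < N by rewrite index_mem.
have : index x w != index y w.
  by apply: contraNneq xy => E; rewrite -(nth_index x xw) E nth_index.
by case: goes_right; case: goes_right => /=; lia.
Qed.

Lemma strand_right x : x \in w -> rightward (strand x) = goes_right x.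
Proof.
move=> xw; have lt_x : index x w < N by rewrite index_mem.
by rewrite rightward_even strandE; case: goes_right => /=; lia.
Qed.

(** [letter_at] also gives a letter to the unchosen strand of each position, and the default one to
    strand 0; the membership test leaves these strands unmatched. *)
Definition mate (i : 'I_n) : 'I_n :=
  if i \in map strand w then strand (flip (letter_at i)) else i.

Lemma mate_strand x : x \in w -> mate (strand x) = strand (flip x).
Proof. by move=> xw; rewrite /mate map_f // strandK. Qed.

Lemma mate_neq i : (mate i != i) = (i \in map strand w).
Proof.
case: (boolP (i \in _)) => [/mapP[x xw ->]|/negbTE iw]; last first.
  by rewrite /mate iw eqxx.
rewrite mate_strand //; apply: contraNneq (flip_neq x) => E.
by rewrite -[flip x]strandK ?mem_flip // E strandK.
Qed.

Lemma mateK : involutive mate.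
Proof.
move=> i; case: (boolP (i \in map strand w)) => [/mapP[x xw ->]|/negbTE iw].
  by rewrite !mate_strand ?mem_flip // flipK.
by rewrite {2}/mate iw /mate iw.
Qed.

Definition strand_over (i : 'I_n) : bool := over (letter_at i).

Lemma strand_over_mate i : mate i != i ->
  strand_over (mate i) = ~~ strand_over i.
Proof.
rewrite mate_neq => /mapP[x xw ->]; rewrite mate_strand //.
by rewrite /strand_over !strandK ?mem_flip.
Qed.

Definition code_crossing : virtual_crossing n :=
  matching_crossing mateK strand_over_mate.

(** The understrand [u] always goes right, so the sign is [(o < u) == rightward o]; [goes_right]
    solves this for the direction of the overstrand [o]. *)
Lemma code_crossing_sign x : x \in w ->
  crossing_sign code_crossing (strand x) (strand (flip x)) = sign x.
Proof.
move=> xw; have fw := mem_flip xw.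
rewrite /crossing_sign -mate_strand // matching_above ?mate_neq ?map_f //.
rewrite mate_strand // /strand_over strandK //.
have xf : x != flip x by rewrite eq_sym flip_neq.
have over_flip : over (flip x) = ~~ over x by [].
have sign_flip : sign (flip x) = sign x by [].
case: ifP => ox; rewrite !strand_right // strand_ltE ?flip_neq //;
  rewrite /goes_right over_flip sign_flip ox flipK /=;
  by case: (_ < _); case: sign.
Qed.

(** * Reading the word of the petal diagram *)

Variable c : seq ('I_n * 'I_n).
Hypothesis c_res : is_resolution c.

Definition crossing_index (x : letter) : nat :=
  find (mate_pair mate (strand x)) c.

(** As numbers, both sides are strictly decreasing lists with the same members. *)
Lemma strand_order :
  [seq i <- pmap insub [seq e %% n | e <- entries n] | i \in map strand w]
  = map strand w.
Proof.
apply: (inj_map val_inj).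
have val_order : map val (pmap insub [seq e %% n | e <- entries n] : seq 'I_n)
    = 0 :: rev (iota 1 N.*2).
  rewrite entries_strands (pmap_filter (insubK _)); apply/all_filterP/allP => i.
  rewrite inE mem_rev mem_iota => Hi.
  by rewrite isSome_insub; lia.
pose strands := map val (map strand w).
have strands_gt0 k : k \in strands -> 0 < k.
  case/mapP => _ /mapP[x xw ->] ->; rewrite /= strandE.
  have : index x w < N by rewrite index_mem.
  by case: goes_right => /=; lia.
rewrite (eq_filter (a2 := preim val (mem strands))); last first.
  by move=> i; rewrite /= (mem_map val_inj).
rewrite -filter_map val_order /= ifN; last by apply/negP => /strands_gt0.
have gtn_trans : transitive gtn by move=> ? ? ? /=; lia.
have gtn_irr : irreflexive gtn by move=> ? /=; lia.
apply: (irr_sorted_eq gtn_trans gtn_irr).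
- apply: sorted_filter => //; rewrite rev_sorted; exact: iota_ltn_sorted.
- rewrite -map_comp; apply/(sortedP 0) => k; rewrite size_map => lt_k.
  have lt_k' := ltnW lt_k; rewrite !(nth_map (0, false, false)) //=.
  set x := nth _ _ _; set y := nth _ _ k.
  have xw : x \in w by rewrite mem_nth.
  have yw : y \in w by rewrite mem_nth //; lia.
  have ix : index x w = k.+1 by rewrite index_uniq ?gauss_uniq.
  have iy : index y w = k by rewrite index_uniq ?gauss_uniq //; lia.
  by rewrite strand_ltE ?ix ?iy //; apply/eqP => E; move: ix; rewrite E iy; lia.
move=> k; rewrite mem_filter /= -/strands.
case: (boolP (k \in strands)) => //= ks; have k0 := strands_gt0 k ks.
have [i _ Ek] := mapP ks.
by rewrite mem_rev mem_iota k0 Ek /= add1n ltn_ord.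
Qed.

Lemma petal_word_code :
  petal_word code_crossing c
  = [seq (crossing_index x, over x, sign x) | x <- w].
Proof.
pose L i := (find (mate_pair mate i) c, strand_over i,
             crossing_sign code_crossing i (mate i)).
rewrite /petal_word (eq_map (g := fun i =>
    if i \in map strand w then [:: L i] else [::])); last first.
  by move=> i; rewrite matching_strand_word // mate_neq.
rewrite flatten_map_if strand_order -map_comp; apply/eq_in_map => x xw /=.
rewrite /L mate_strand // code_crossing_sign // /strand_over strandK //.
Qed.

Lemma crossing_index_flip x : x \in w ->
  crossing_index (flip x) = crossing_index x.
Proof.
move=> xw; rewrite /crossing_index -mate_strand //.
exact: find_mate_pair_mate mateK _ _.
Qed.

Lemma crossing_index_inj x y : x \in w -> y \in w ->
  crossing_index x = crossing_index y -> label x = label y.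
Proof.
move=> xw yw E.
have ix : mate (strand x) != strand x by rewrite mate_neq map_f.
have iy : mate (strand y) != strand y by rewrite mate_neq map_f.
have [Ey|Ey] := find_mate_pair_inj c_res ix iy E.
  by rewrite -(strandK yw) Ey strandK.
by rewrite -(strandK yw) Ey mate_strand // strandK ?mem_flip.
Qed.

(** The index of a crossing in [c] depends only on the label of the letter and separates distinct
    labels. *)
Lemma petal_word_relabel : exists2 f : nat -> nat, injective f &
  petal_word code_crossing c = [seq (f (label x), over x, sign x) | x <- w].
Proof.
(* Either of the two letters labelled [a] would do, as they share their crossing index. *)
pose rep a := nth (0, false, false) w (find (fun y => label y == a) w).
have repP a : a \in map label w -> rep a \in w /\ label (rep a) = a.
  move=> /mapP[x xw ->].
  have has_x : has (fun y => label y == label x) w.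
    by apply/hasP; exists x.
  by split; [rewrite mem_nth -?has_find | apply/eqP/(nth_find _ has_x)].
have [|f f_inj fE] := @extend_injection (map label w) (crossing_index \o rep).
  move=> a b /repP[aw aE] /repP[bw bE] /= /crossing_index_inj.
  by rewrite aE bE; apply.
exists f => //; rewrite petal_word_code; apply/eq_in_map => x xw.
have [rw rE] := repP _ (map_f label xw).
rewrite fE ?map_f //=; congr (_, _, _).
by have [->|->] := same_label xw rw rE; rewrite ?crossing_index_flip.
Qed.

End GaussWord.

Lemma relabel_gauss_word (f : nat -> nat) w : injective f ->
  is_gauss_word w -> is_gauss_word [seq (f (label x), over x, sign x) | x <- w].
Proof.
move=> f_inj w_code; apply/allP => _ /mapP[x xw ->] /=.
have [cx fx] := andP (allP w_code x xw).
rewrite count_map (eq_count (a2 := fun y => label y == label x)) ?cx => [|y /=].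
  by apply/mapP; exists (flip x).
by rewrite /label /= (inj_eq f_inj).
Qed.

Theorem theorem5p1 (K : virtual_knot) :
  exists P : virtual_petal_diagram, petal_diagram_of P K.
Proof.
have [D DK] := knot_codeP K.
have D_code := gauss_wordP D.
exists (VirtualPetalDiagram (code_crossing D_code) (ltn0Sn _) (entries_curve _)).
split; first exact: resolution_exists.
move=> c c_res; have [f f_inj E] := petal_word_relabel D_code c_res.
(* Here [f] depends on the resolution [c], but the resulting code is always one [relabel] move away
   from [D]. *)
exists (GaussCode (relabel_gauss_word f_inj D_code)) => //.
by apply/DK; apply: rst_step; apply: relabel.
Qed.
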